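(* Let $\Lambda$ be an admissible set and let $\varepsilon$ be a positive number. For every $n\in\mathbb{Z}$ let $a_n$ denote the cardinality of $\Lambda\cap[n\varepsilon,(n+1)\varepsilon)$. If $$\limsup_{n\to\infty}\frac{a_n}{a_{n-1}}=\infty$$ (where $\frac{0}{0}=0$ and $\frac{c}{0}=\infty$ if $c>0$), then $\Lambda$ is type 2.
   Context: A set $\Lambda\subset\mathbb{R}$ is called admissible if it is countably infinite, unbounded, bounded from below, and has no finite accumulation points. Let $\mu$ denote Lebesgue measure on $\mathbb{R}$. For an admissible $\Lambda$ and a (Lebesgue) measurable $f:\mathbb{R}\to[0,+\infty)$, put $s(x)=\sum_{\lambda\in\Lambda}f(x+\lambda)$, $C(f,\Lambda)=\{x\in\mathbb{R}: s(x)<\infty\}$ and $D(f,\Lambda)=\{x\in\mathbb{R}: s(x)=\infty\}$. The set $\Lambda$ is type 1 if for every measurable $f:\mathbb{R}\to[0,+\infty)$ either $\mu(D(f,\Lambda))=0$ or $\mu(C(f,\Lambda))=0$. Otherwise $\Lambda$ is type 2. *)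

(* Defs.v *)
From HB Require Import structures.
From mathcomp Require Import all_boot all_order all_algebra.
From mathcomp Require Import all_classical all_reals all_analysis.
Import Order.TTheory GRing.Theory Num.Theory numFieldNormedType.Exports.

Set Implicit Arguments.
Unset Strict Implicit.
Unset Printing Implicit Defensive.

Local Open Scope classical_set_scope.
Local Open Scope ring_scope.

Definition admissible (R : realType) (L : set R) : Prop :=
  [/\ countable L, infinite_set L, ~ bounded_set L, has_lbound L
    & limit_point L = set0].

(* The domain carries the sigma-algebra of all Lebesgue measurable sets (the
   one on which [completed_lebesgue_measure] is defined), not only the Borel
   sets; the codomain carries the Borel sigma-algebra. *)
Definition lebesgue_measurable_fun (R : realType) (f : R -> R) : Prop :=
  @measurable_fun _ _ (caratheodory_type ((@wlength R idfun)^*)%mu)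
    (measurableTypeR R) setT f.

Definition shift_sum (R : realType) (f : R -> R) (L : set R) (x : R) : \bar R :=
  (\esum_(l in L) (f (x + l))%:E).

Definition conv_set (R : realType) (f : R -> R) (L : set R) : set R :=
  [set x | (shift_sum f L x < +oo)%E].

Definition div_set (R : realType) (f : R -> R) (L : set R) : set R :=
  [set x | shift_sum f L x = +oo%E].

Definition type1 (R : realType) (L : set R) : Prop :=
  forall f : R -> R, lebesgue_measurable_fun f -> (forall x, 0 <= f x) ->
    completed_lebesgue_measure (div_set f L) = 0%E \/
    completed_lebesgue_measure (conv_set f L) = 0%E.

Definition type2 (R : realType) (L : set R) : Prop := ~ type1 L.

(* Extended-real valued, with value +oo when the intersection is infinite
   (which does not happen for admissible [L]). *)
Definition block_card (R : realType) (L : set R) (eps : R) (n : int) : \bar R :=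
  counting (L `&` `[n%:~R * eps, (n + 1)%:~R * eps[).

(* Extended-real division follows the conventions 0/0 = 0 and
   c/0 = +oo for c > 0. *)
Lemma zero_div_zero (R : realType) : (0 / 0 = 0 :> \bar R)%E.
Proof. by rewrite mul0e. Qed.

Lemma pos_div_zero (R : realType) (c : \bar R) : (0 < c -> c / 0 = +oo)%E.
Proof. by move=> c0; rewrite inve0 gt0_muley. Qed.

(* Main.v *)
Require Import Defs.
From HB Require Import structures.
From mathcomp Require Import all_boot all_order all_algebra.
From mathcomp Require Import all_classical all_reals all_analysis.
From mathcomp Require Import measurable_realfun lra.
Import Order.TTheory GRing.Theory Num.Theory numFieldNormedType.Exports.

(** Write [a_n] for the cardinality of the block of [L] in
    [[n eps, (n+1) eps)].  Since the ratios [a_n / a_(n-1)] are unbounded at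
    infinity, there are indices [n_k >= k] and weights [c_k = 1 / a_(n_k)] for
    which [sum_k c_k a_(n_k)] diverges while [sum_k c_k a_(n_k - 1)] converges
    ([divergent_block_weights]).  The witness against type 1 is
    [f = sum_k c_k 1_(S_k)] with [S_k = [n_k eps, n_k eps + 3/4 eps)].

    The term of index [k] contributes [c_k] times the number of points of [L]
    in the window [S_k - x] to the sum at [x] ([esum_weighted_indic]), so only
    the position of the windows matters.
    - For [x] in [[3/4 eps, eps]] every window lies inside block [n_k - 1],
      hence the sum at [x] is at most [sum_k c_k a_(n_k - 1)], which is finite.
    - For [x] in [[0, eps/4]] the window contains the left half of block [n_k],
      and for [y] in [[-eps/2, -eps/4]] the right half.  For such [x] and [y]
      the two sums together are at least [sum_k c_k a_(n_k)], so they cannot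
      both be finite.  Consequently the sum is infinite on all of
      [[0, eps/4]] or on all of [[-eps/2, -eps/4]].
    Both the convergence and the divergence set thus contain a nondegenerate
    interval.  Using two independent points instead of one translated point
    lets the points of a block cluster anywhere, and in a way that varies
    with [k].

    Taking [n_k >= k] makes [f] finite: below a given real number only finitely
    many of the [S_k] begin. *)

Set Implicit Arguments.
Unset Strict Implicit.
Unset Printing Implicit Defensive.

Local Open Scope classical_set_scope.
Local Open Scope ring_scope.

Lemma esum_exchange (R : realType) (T1 T2 : choiceType) (I : set T1)
    (J : set T2) (a : T1 -> T2 -> \bar R) :
  (forall i j, (0 <= a i j)%E) ->
  (\esum_(i in I) \esum_(j in J) a i j = \esum_(j in J) \esum_(i in I) a i j)%E.
Proof.
move=> a0; rewrite !esum_esum //.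
rewrite (reindex_esum (I `*`` (fun=> J)) _ (fun x => (x.2, x.1))) //.
split=> [[x y] /= [] //|[x y] [x' y'] _ _ /= [-> ->] //|[x y] /= [Jx Iy]].
by exists (y, x).
Qed.

Lemma esum_indic (R : realType) (T : choiceType) (L A : set T) (c : R) :
  0 <= c -> finite_set (L `&` A) ->
  (\esum_(l in L) (c * \1_A l)%:E = c%:E * counting (L `&` A))%E.
Proof.
move=> c0 finA.
transitivity (\esum_(l in L `&` A) c%:E)%E.
  rewrite esum_mkcondr; apply: eq_esum => l _.
  by rewrite indicE; case: (l \in A); rewrite ?mulr1 ?mulr0.
rewrite esum_fset //.
rewrite /counting asboolT // fsbig_finite //= sumEFin.
by rewrite big_const_seq count_predT iter_addr_0 -[in LHS]mulr_natr EFinM.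
Qed.

(** The sum is taken in the extended reals so that it can be exchanged with
    sums over [L]; [weighted_indic_fin_num] tells when it is a real number. *)
Definition weighted_indic (R : realType) (T : choiceType) (c : nat -> R)
    (A : nat -> set T) (y : T) : \bar R :=
  (\sum_(k <oo) (c k * \1_(A k) y)%:E)%E.

(** Tonelli: summing a weighted family of indicators over [L] counts, for each
    index, the points of [L] in the corresponding set. *)
Lemma esum_weighted_indic (R : realType) (T : choiceType) (L : set T)
    (c : nat -> R) (A : nat -> set T) :
  (forall k, 0 <= c k) -> (forall k, finite_set (L `&` A k)) ->
  (\esum_(l in L) weighted_indic c A l =
   \sum_(k <oo) (c k)%:E * counting (L `&` A k))%E.
Proof.
move=> c0 finA.
have ge0 k l : (0 <= (c k * \1_(A k) l)%:E)%E by rewrite lee_fin mulr_ge0.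
under eq_esum do rewrite /weighted_indic nneseries_esumT //.
rewrite esum_exchange // -nneseries_esumT => [|k]; last exact: esum_ge0.
by apply: eq_eseriesr => k _; rewrite esum_indic.
Qed.

(** With [B] a family of windows, this turns a covering of [A k] by two
    translates of [B k] into a lower bound for the sum of two shifted sums. *)
Lemma le_weighted_indicD (R : realType) (T : choiceType) (c : nat -> R)
    (A B : nat -> set T) (x y z : T) :
  (forall k, 0 <= c k) -> (forall k, A k x -> B k y \/ B k z) ->
  (weighted_indic c A x <= weighted_indic c B y + weighted_indic c B z)%E.
Proof.
move=> c0 ABB; rewrite /weighted_indic -nneseriesD; first last.
- by move=> k _ _; rewrite lee_fin mulr_ge0.
- by move=> k _ _; rewrite lee_fin mulr_ge0.
apply: lee_nneseries => k _; first by rewrite lee_fin mulr_ge0.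
rewrite -EFinD lee_fin -mulrDr ler_wpM2l // !indicE.
have [/set_mem/ABB[|]|_] := boolP (x \in A k); last by rewrite addr_ge0.
- by move=> /mem_set ->; rewrite lerDl.
- by move=> /mem_set ->; rewrite lerDr.
Qed.

Lemma le_weighted_indic (R : realType) (T : choiceType) (c : nat -> R)
    (A B : nat -> set T) (x y : T) :
  (forall k, 0 <= c k) -> (forall k, A k x -> B k y) ->
  (weighted_indic c A x <= weighted_indic c B y)%E.
Proof.
move=> c0 AB; apply: lee_nneseries => k _; first by rewrite lee_fin mulr_ge0.
rewrite lee_fin ler_wpM2l // !indicE.
by have [/set_mem/AB/mem_set ->|] := boolP (x \in A k).
Qed.

Lemma weighted_indic_fin_num (R : realType) (T : choiceType) (c : nat -> R)
    (A : nat -> set T) (y : T) (N : nat) :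
  (forall k, 0 <= c k) -> (forall k, (N <= k)%N -> ~ A k y) ->
  weighted_indic c A y \is a fin_num.
Proof.
move=> c0 yA; rewrite /weighted_indic.
rewrite (nneseries_split _ N) => [|k _]; last first.
  by rewrite lee_fin mulr_ge0.
rewrite [X in (_ + X)%E]eseries0 => [|k Nk _].
  by rewrite adde0 sumEFin.
by rewrite indicE memNset ?mulr0 //; exact: yA.
Qed.

Lemma weighted_indic_measurable (R : realType) (c : nat -> R)
    (A : nat -> set R) :
  (forall k, 0 <= c k) -> (forall k, measurable (A k)) ->
  measurable_fun setT (fun y => fine (weighted_indic c A y)).
Proof.
move=> c0 mA; apply: (measurableT_comp (fine_measurable measurableT)).
apply: (@ge0_emeasurable_sum _ _ _ setT
  (fun k y => (c k * \1_(A k) y)%:E) xpredT).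
  by move=> k y _ _; rewrite lee_fin mulr_ge0.
by move=> k _; apply/measurable_EFinP; exact: measurable_funM.
Qed.

Lemma borel_lebesgue_measurable (R : realType) (f : R -> R) :
  measurable_fun setT f -> lebesgue_measurable_fun f.
Proof.
by move=> mf _ B mB; apply: sub_caratheodory; exact: mf.
Qed.

(** The completed measure is the Lebesgue outer measure, which is monotone on
    arbitrary sets. *)
Lemma completed_lebesgue_measure_itv_sub (R : realType) (a b : R) (A : set R) :
  a < b -> `[a, b] `<=` A -> completed_lebesgue_measure A <> 0%E.
Proof.
move=> ab abA A0.
have : (lebesgue_measure (`[a, b] : set R) <= completed_lebesgue_measure A)%E.
  exact: (le_outer_measure ((wlength idfun)^*)%mu).
rewrite A0 lebesgue_measure_itv /= lte_fin ab -EFinB lee_fin.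
by rewrite subr_le0 leNgt ab.
Qed.

Lemma limn_esup_pinfty_gt (R : realType) (u : nat -> \bar R) (M : R) (N : nat) :
  limn_esup u = +oo%E -> exists2 n, (N <= n)%N & (M%:E < u n)%E.
Proof.
rewrite /limn_esup limf_esupE => u_oo.
have : (M%:E < ereal_sup (u @` [set n | (N <= n)%N]))%E.
  apply: (@lt_le_trans _ _ +oo%E); first exact: ltry.
  rewrite -u_oo; apply: ereal_inf_lbound.
  by exists [set n | (N <= n)%N] => //; exists N.
by case/ereal_sup_gt => _ [n /= Nn <-] Mn; exists n.
Qed.

(** With the convention [p / 0 = +oo] for [p > 0], a large ratio carries no
    lower bound on [p] beyond [p > 0] when [q = 0]; hence the first conclusion,
    which makes [p^-1] usable as a weight in that case too. *)
Lemma lt_natr_div (R : realType) (p q : nat) (M : R) :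
  0 <= M -> (M%:E < p%:R%:E / q%:R%:E)%E -> (0 < p)%N /\ M * q%:R <= p%:R.
Proof.
move=> M0 Mpq; have p0 : (0 < p)%N.
  rewrite lt0n; apply/eqP => p0; move: Mpq.
  by rewrite p0 mul0e lte_fin ltNge M0.
split=> //; have [->|q0] := posnP q; first by rewrite mulr0.
move: Mpq; rewrite inver pnatr_eq0 gtn_eqF // -EFinM lte_fin.
by rewrite ltr_pdivlMr ?ltr0n // => /ltW.
Qed.

(** By Bolzano-Weierstrass, an infinite bounded part would accumulate. *)
Lemma finite_setI_itv (R : realType) (L : set R) (a b : R) :
  limit_point L = set0 -> finite_set (L `&` `[a, b[).
Proof.
move=> L0; apply: contrapT => infL.
have [|x Lx] := infinite_bounded_limit_point_nonempty infL.
  exists (`|a| + `|b|); split; first exact: num_real.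
  move=> M ltM x [_ /=]; rewrite in_itv /= => /andP[ax xb].
  apply: le_trans (ltW ltM); rewrite ler_norml.
  have := ler_norm b; have := ler_norm (- a); rewrite normrN.
  by have := normr_ge0 a; have := normr_ge0 b; lra.
have : limit_point L x by move=> U /Lx[y [yx [Ly _] Uy]]; exists y.
by rewrite L0.
Qed.

Lemma nneseries1 (R : realType) : (\sum_(k <oo) (1 : \bar R) = +oo)%E.
Proof.
apply/eqyP => M M0.
apply: (@le_trans _ _ (\sum_(0 <= k < (Num.truncn M).+1) (1 : \bar R))%E).
  rewrite sumEFin big_const_nat iter_addr_0 subn0 lee_fin.
  exact/ltW/truncnS_gt.
by apply: nneseries_lim_ge.
Qed.

(** The weight [c k] is the inverse of the size of block [n_ k], chosen so that
    this block is at least [2 ^ (k + 1)] times as large as the preceding one: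
    the terms of the first series are all 1, and those of the second are
    bounded by a geometric series of sum 1. *)
Lemma divergent_block_weights (R : realType) (L : set R) (eps : R) :
  limit_point L = set0 ->
  limn_esup (fun n : nat =>
    (block_card L eps n%:Z / block_card L eps (n%:Z - 1))%E) = +oo%E ->
  exists n_ : nat -> nat, exists c : nat -> R,
    [/\ forall k, (k <= n_ k)%N, forall k, 0 <= c k,
        (\sum_(k <oo) (c k)%:E * block_card L eps (n_ k)%:Z = +oo)%E &
        (\sum_(k <oo) (c k)%:E * block_card L eps ((n_ k)%:Z - 1)%R < +oo)%E].
Proof.
move=> L0 u_oo.
have block_nat n : exists p : nat, block_card L eps n = p%:R%:E.
  rewrite /block_card /counting asboolT; last exact: finite_setI_itv.
  by eexists.
have [a blockE] := choice block_nat.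
have jump k : exists n : nat, [/\ (k <= n)%N, (0 < a n%:Z)%N &
    (2 ^ k.+1)%:R * (a (n%:Z - 1))%:R <= (a n%:Z)%:R :> R].
  have [n kn] := limn_esup_pinfty_gt (2 ^ k.+1)%:R k u_oo.
  by rewrite !blockE => /lt_natr_div[|an0 ltan]; [exact: ler0n|exists n].
have [n_ jumpn] := choice jump.
exists n_, (fun k => (a (n_ k)%:Z)%:R^-1); split.
- by move=> k; have [] := jumpn k.
- by move=> k; rewrite invr_ge0.
- rewrite -[RHS]nneseries1; apply: eq_eseriesr => k _.
  have [_ an0 _] := jumpn k.
  by rewrite blockE -EFinM mulVf // pnatr_eq0 -lt0n.
- apply: (@le_lt_trans _ _ (\sum_(k <oo) (1 / (2 ^ (k + 1))%:R)%:E)%E).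
    apply: lee_nneseries => k _; first by rewrite blockE lee_fin mulr_ge0.
    have [_ an0 an] := jumpn k.
    rewrite blockE -EFinM lee_fin div1r mulrC ler_pdivrMr ?ltr0n //.
    by rewrite mulrC ler_pdivlMr ?ltr0n ?expn_gt0 // mulrC addn1.
  have /cvg_lim := @cvg_geometric_eseries_half R 1 0.
  by rewrite /eseries => ->; rewrite ?ltry.
Qed.

Theorem theorem2p1 (R : realType) (L : set R) (eps : R) :
  admissible L -> 0 < eps ->
  limn_esup (fun n : nat =>
    (block_card L eps n%:Z / block_card L eps (n%:Z - 1))%E) = +oo%E ->
  type2 L.
Proof.
move=> [_ _ _ _ L0] eps0 /(divergent_block_weights L0)[n_ [c []]].
move=> le_n c0 sum_oo sum_fin t1.
pose block (n : int) : set R := `[n%:~R * eps, (n + 1)%:~R * eps[%classic.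
pose S k : set R := `[(n_ k)%:R * eps, (n_ k)%:R * eps + 3 / 4 * eps[%classic.
pose f y := fine (weighted_indic c S y).
(* A set S k that contains y satisfies k <= n_ k <= y / eps. *)
have fE y : (f y)%:E = weighted_indic c S y.
  apply: fineK.
  apply: (weighted_indic_fin_num (N := (Num.truncn (y / eps)).+1)).
    exact: c0.
  move=> k Nk; rewrite /S /= in_itv /= => /andP[ny _].
  have : y / eps < (n_ k)%:R.
    apply: lt_le_trans (truncnS_gt _) _.
    by rewrite ler_nat (leq_trans Nk).
  by rewrite ltr_pdivrMr // ltNge ny.
have sumE x : shift_sum f L x = (\esum_(l in L) weighted_indic c S (x + l)%R)%E.
  by apply: eq_esum => l _; rewrite fE.
have f0 y : 0 <= f y.
  by rewrite fine_ge0 // nneseries_ge0 // => k _ _; rewrite lee_fin mulr_ge0.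
have mf : lebesgue_measurable_fun f.
  apply: borel_lebesgue_measurable; apply: weighted_indic_measurable => // k.
  exact: measurable_itv.
have blocksE (m : nat -> int) :
    (\esum_(l in L) weighted_indic c (fun k => block (m k)) l =
     \sum_(k <oo) (c k)%:E * block_card L eps (m k))%E.
  by apply: esum_weighted_indic => // k; exact: finite_setI_itv.
(* The window S k - x lies between (n_ k - 1) eps and n_ k eps. *)
have convC : `[3 / 4 * eps, eps] `<=` conv_set f L.
  move=> x; rewrite /= in_itv /= => /andP[xl xr].
  rewrite /conv_set /= sumE; apply: le_lt_trans sum_fin; rewrite -blocksE.
  apply: le_esum => l _; apply: le_weighted_indic => // k.
  rewrite /S /block /= !in_itv /= subrK intrB mulrBl mul1r => /andP[].
  by rewrite -pmulrn => *; apply/andP; split; lra.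
(* The windows S k - x and S k - y cover the left and the right half of the
   block n_ k. *)
have divD x y : x \in `[0, eps / 4] -> y \in `[- (eps / 2), - (eps / 4)] ->
    (shift_sum f L x + shift_sum f L y)%E = +oo%E.
  rewrite !in_itv /= => /andP[xl xr] /andP[yl yr].
  have w0 A z : (0 <= weighted_indic c A z)%E.
    by apply: nneseries_ge0 => k _ _; rewrite lee_fin mulr_ge0.
  rewrite !sumE -esumD //.
  apply/eqP; rewrite -leye_eq -sum_oo -blocksE.
  apply: le_esum => l _; apply: le_weighted_indicD => // k.
  rewrite /S /block /= !in_itv /= intrD mulrDl mul1r -pmulrn => /andP[nl ln].
  have [lh|lh] := ltP l ((n_ k)%:R * eps + eps / 2).
    by left; apply/andP; split; lra.
  by right; apply/andP; split; lra.
have [D0|C0] := t1 f mf f0; last first.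
  by apply: completed_lebesgue_measure_itv_sub convC C0; lra.
have itvD a b : a < b -> exists2 x, x \in `[a, b] & (shift_sum f L x < +oo)%E.
  move=> ab; apply: contrapT => noconv.
  apply: completed_lebesgue_measure_itv_sub ab _ D0 => x xab.
  apply/eqP; rewrite -leye_eq leNgt; apply/negP => xfin.
  by apply: noconv; exists x.
have [|x xJ xfin] := itvD 0 (eps / 4); first by lra.
have [|y yJ yfin] := itvD (- (eps / 2)) (- (eps / 4)); first by lra.
by have := lte_add_pinfty xfin yfin; rewrite divD.
Qed.
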